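(* Let $n\geq2$ be an integer. Put $G=SO(n)$ and $H=SO(n-1)=\left\{\begin{pmatrix}1&\\&k\end{pmatrix}\,\middle|\,k\in SO(n-1)\right\}\subset G$. Let $\rho\colon G\to GL(\mathbb{R}^n\oplus\mathrm{Sym}(n,\mathbb{R}))$ be the representation given by $$\rho(g)(v,S):=(gv,gSg^{T})\qquad((v,S)\in\mathbb{R}^n\oplus\mathrm{Sym}(n,\mathbb{R})).$$ Then $v_0:=(e_1,E_{11})\in\mathbb{R}^n\oplus\mathrm{Sym}(n,\mathbb{R})$ is $H$-fixed, and the family $\mathcal{P}$ obtained from $(G,H,\mathbb{R}^n\oplus\mathrm{Sym}(n,\mathbb{R}),v_0)$ by the method described in the context, under the identification $SO(n)/SO(n-1)\simeq S^{n-1}$, $gSO(n-1)\mapsto ge_1$, is the family of Fisher--Bingham distributions on $S^{n-1}$, $$\left\{c_{\mu,A}\exp(-\mu^{T}x-x^{T}Ax)\,dx\right\}_{(\mu,A)\in\mathbb{R}^n\oplus\mathrm{Sym}(n,\mathbb{R})},$$ where $c_{\mu,A}$ is the corresponding normalizing constant.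
   Context: $e_1$ is the first standard basis vector, $E_{11}$ the matrix unit, $\mathrm{Sym}(n,\mathbb{R})$ the space of real symmetric $n\times n$ matrices, and $dx$ the uniform ($SO(n)$-invariant) measure on $S^{n-1}$. The method: let $G$ be a Lie group with finitely many connected components, $H$ a closed subgroup, $X:=G/H$, $\rho\colon G\to GL(V)$ a continuous finite dimensional real representation and $v_0\in V$ an $H$-fixed vector. Put $W_0(G,H):=\{\tau\colon G\to\mathbb{R}\mid\tau\text{ is a continuous group homomorphism with }\tau|_H=0\}$. Take a nonzero relatively $G$-invariant Radon measure $\nu$ on $X$ (i.e. for some $\chi\colon G\to\mathbb{R}_{>0}$ the pushforward satisfies $g\cdot\nu=\chi(g)^{-1}\nu$ for all $g\in G$), assumed to exist; the resulting family does not depend on the choice of $\nu$. For $\theta=(\varphi,\tau)\in V^\vee\times W_0(G,H)$ and $x=gH$, put $\rho(x)v_0:=\rho(g)v_0$, $\tau(x):=\tau(g)$ and $d\tilde p_\theta(x):=\exp(-\langle\varphi,\rho(x)v_0\rangle+\tau(x))\,d\nu(x)$. Let $\Theta:=\{\theta\in V^\vee\times W_0(G,H)\mid\int_Xd\tilde p_\theta<\infty\}$ and, for $\theta\in\Theta$, $p_\theta:=(\int_Xd\tilde p_\theta)^{-1}\tilde p_\theta$. The family obtained is the set $\mathcal{P}:=\{p_\theta\}_{\theta\in\Theta}$ of probability measures on $X$. *)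

(* Defs.v *)
From HB Require Import structures.
From mathcomp Require Import all_boot all_order all_algebra.
From mathcomp Require Import all_classical all_reals all_analysis.

Set Implicit Arguments.
Unset Strict Implicit.
Unset Printing Implicit Defensive.
Import Order.TTheory GRing.Theory Num.Theory.
Import numFieldNormedType.Exports.

Local Open Scope classical_set_scope.
Local Open Scope quotient_scope.
Local Open Scope ring_scope.

HB.mixin Record isTopologicalGroup G of Group G & Topological G := {
  mulg_continuous : continuous (fun p : G * G => (p.1 * p.2)%g) ;
  invg_continuous : continuous (fun x : G => (x^-1)%g)
}.

#[short(type="topGroupType")]
HB.structure Definition TopologicalGroup :=
  {G of isTopologicalGroup G & Group G & Topological G}.

Section coset_space.
Context {G : topGroupType} (H : groupClosed G).
Local Open Scope group_scope.

Definition same_coset (x y : G) : bool := (x^-1 * y) \in H.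

Lemma same_coset_refl : reflexive same_coset.
Proof. by move=> x; rewrite /same_coset mulVg gpred1. Qed.

Lemma same_coset_sym : symmetric same_coset.
Proof. by move=> x y; rewrite /same_coset -[RHS]gpredV invgM invgK. Qed.

Lemma same_coset_trans : transitive same_coset.
Proof.
move=> y x z xy yz; rewrite /same_coset.
have -> : x^-1 * z = (x^-1 * y) * (y^-1 * z) by rewrite mulgA mulgK.
exact: gpredM.
Qed.

Definition same_coset_equiv :=
  EquivRel same_coset same_coset_refl same_coset_sym same_coset_trans.

Definition coset_space : Type := quotient_topology {eq_quot same_coset_equiv}.

HB.instance Definition _ := Topological.on coset_space.
HB.instance Definition _ := Quotient.on coset_space.
HB.instance Definition _ := isPointed.Build coset_space
  (\pi_(quotient_topology {eq_quot same_coset_equiv})%qT (1 : G)).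

Definition coset_pi (g : G) : coset_space := \pi_coset_space%qT g.

Definition coset_act (g : G) (x : coset_space) : coset_space :=
  coset_pi (g * repr x).

End coset_space.

Definition homeomorphism (X Y : topologicalType) (f : X -> Y) : Prop :=
  continuous f /\
  exists h : Y -> X, [/\ continuous h, cancel f h & cancel h f].

Notation borel X := (g_sigma_algebraType (@open X)).

Section radon.
Context {R : realType} {X : ptopologicalType}.
Local Open Scope ereal_scope.

Definition radon (mu : {measure set (borel X) -> \bar R}) : Prop :=
  [/\ forall K : set X, compact K -> mu K < +oo,
      forall A : set (borel X), measurable A ->
        mu A = ereal_inf [set mu U | U in [set U : set X | open U /\ A `<=` U]]
    & forall U : set X, open U ->
        mu U = ereal_sup [set mu K | K in [set K : set X | compact K /\ K `<=` U]]].

End radon.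

Section families.
Context {R : realType}.
Local Open Scope ereal_scope.

Definition weighted d (T : measurableType d) (mu : {measure set T -> \bar R})
    (w : T -> R) (A : set T) : \bar R :=
  \int[mu]_(x in A) (w x)%:E.

Definition has_density d (T : measurableType d) (mu : {measure set T -> \bar R})
    (w : T -> R) (p : probability T R) : Prop :=
  forall A, measurable A ->
    p A = (fine (weighted mu w setT))^-1%:E * weighted mu w A.

(* Values on non-measurable sets are junk, so measures are compared on
   measurable sets only. *)
Definition image_family d d' (T : measurableType d) (T' : measurableType d')
    (f : T -> T') (P : set (probability T R)) : set (probability T' R) :=
  [set q | exists2 p, P p &
     forall B, measurable B -> q B = pushforward p f B].

End families.

Section method.
Context {R : realType} {G : topGroupType} (H : groupClosed G).
Variables (V : vectType R) (rho : G -> V -> V).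

(* [V] carries its canonical finite dimensional topology, so continuity means
   continuity of all matrix coefficients. *)
Definition continuous_representation : Prop :=
  [/\ forall g, linear (rho g),
      forall v, rho 1%g v = v,
      forall g h v, rho (g * h)%g v = rho g (rho h v)
    & forall (phi : 'Hom(V, R^o)) (v : V),
        continuous (fun g => phi (rho g v) : R)].

Definition fixed_by (v : V) : Prop := forall h, h \in H -> rho h v = v.

Definition relatively_invariant
    (nu : {measure set (borel (coset_space H)) -> \bar R}) : Prop :=
  exists2 chi : G -> R, (forall g, 0 < chi g) &
    forall g (A : set (borel (coset_space H))), measurable A ->
      pushforward nu (coset_act g : borel (coset_space H) -> borel _) A
      = ((chi g)^-1%:E * nu A)%E.

Definition admissible_measure
    (nu : {measure set (borel (coset_space H)) -> \bar R}) : Prop :=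
  [/\ radon nu, nu setT != 0%E & relatively_invariant nu].

Definition W0 : set (G -> R) :=
  [set tau | [/\ continuous tau,
                 forall g h, tau (g * h)%g = tau g + tau h
               & forall h, h \in H -> tau h = 0]].

Variables (v0 : V) (nu : {measure set (borel (coset_space H)) -> \bar R}).

(* [rho (repr x) v0] and [tau (repr x)] do not depend on the representative
   when [v0] is fixed by [H] and [tau] is in [W0]. *)
Definition method_weight (theta : 'Hom(V, R^o) * (G -> R))
    (x : borel (coset_space H)) : R :=
  let g := repr (x : coset_space H) in
  expR (- (theta.1 (rho g v0) : R) + theta.2 g).

Definition Theta : set ('Hom(V, R^o) * (G -> R)) :=
  [set theta | W0 theta.2 /\
               (weighted nu (method_weight theta) setT < +oo)%E].

Definition method_family : set (probability (borel (coset_space H)) R) :=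
  [set p | exists2 theta, Theta theta & has_density nu (method_weight theta) p].

End method.

Section mx_continuity.
Context {R : realType}.

Lemma continuous_mx (T : topologicalType) m n (f : T -> 'M[R]_(m, n)) :
  (forall i j, continuous (fun t => f t i j)) -> continuous f.
Proof.
move=> cf t A [P Pt PA]; rewrite nbhs_simpl.
have : \forall s \near t, forall ij : 'I_m * 'I_n, P ij.1 ij.2 (f s ij.1 ij.2).
  by apply: filter_forall => -[i j]; exact: cf.
by apply: filterS => s Ps; apply: PA => i j; exact: (Ps (i, j)).
Qed.

End mx_continuity.

Definition SO_set (R : realType) n : set 'M[R]_n :=
  [set g | g^T *m g = 1%:M /\ \det g = 1].

Arguments SO_set : clear implicits.

Definition SO (R : realType) n : Type := set_type (SO_set R n).

Section special_orthogonal.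
Variable R : realType.

HB.instance Definition _ n := SubType.copy (SO R n) (set_type (SO_set R n)).
HB.instance Definition _ n := Choice.copy (SO R n) (set_type (SO_set R n)).
HB.instance Definition _ n := Topological.copy (SO R n) (set_type (SO_set R n)).

Section group.
Variable n : nat.
Implicit Types g h : SO R n.

Definition SO_mx g : 'M[R]_n := val g.

Lemma SO_trmxK g : (SO_mx g)^T *m SO_mx g = 1%:M.
Proof. by have [] := set_mem (valP g). Qed.

Lemma SO_mxtrK g : SO_mx g *m (SO_mx g)^T = 1%:M.
Proof. by apply/mulmx1C/SO_trmxK. Qed.

Lemma SO_det g : \det (SO_mx g) = 1.
Proof. by have [] := set_mem (valP g). Qed.

Definition mkSO (M : 'M[R]_n) (hM : SO_set R n M) : SO R n :=
  exist _ M (mem_set hM).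

Lemma SO_one_subproof : SO_set R n 1%:M.
Proof. by split; rewrite ?trmx1 ?mulmx1 ?det1. Qed.

Lemma SO_mul_subproof g h : SO_set R n (SO_mx g *m SO_mx h).
Proof.
split; last by rewrite det_mulmx !SO_det mulr1.
by rewrite trmx_mul -mulmxA (mulmxA (SO_mx g)^T) SO_trmxK mul1mx SO_trmxK.
Qed.

Lemma SO_inv_subproof g : SO_set R n (SO_mx g)^T.
Proof. by split; rewrite ?trmxK ?SO_mxtrK ?det_tr ?SO_det. Qed.

Definition SO_one : SO R n := mkSO SO_one_subproof.
Definition SO_mul g h : SO R n := mkSO (SO_mul_subproof g h).
Definition SO_inv g : SO R n := mkSO (SO_inv_subproof g).

Lemma SO_mulA : associative SO_mul.
Proof. by move=> g h k; apply: val_inj; exact: mulmxA. Qed.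
Lemma SO_mul1g : left_id SO_one SO_mul.
Proof. by move=> g; apply: val_inj; exact: mul1mx. Qed.
Lemma SO_mulg1 : right_id SO_one SO_mul.
Proof. by move=> g; apply: val_inj; exact: mulmx1. Qed.
Lemma SO_mulVg : left_inverse SO_one SO_inv SO_mul.
Proof. by move=> g; apply: val_inj; exact: SO_trmxK. Qed.
Lemma SO_mulgV : right_inverse SO_one SO_inv SO_mul.
Proof. by move=> g; apply: val_inj; exact: SO_mxtrK. Qed.

End group.

HB.instance Definition _ n := isGroup.Build (SO R n)
  (@SO_mulA n) (@SO_mul1g n) (@SO_mulg1 n) (@SO_mulVg n) (@SO_mulgV n).

Lemma SO_entry_continuous n (i j : 'I_n) :
  continuous (fun g : SO R n => SO_mx g i j).
Proof.
move=> g; apply: (@continuous_comp _ _ _ (@SO_mx n) (fun M => M i j)).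
  exact: initial_continuous.
exact: coord_continuous.
Qed.

Lemma continuous_SO n (T : topologicalType) (f : T -> SO R n) :
  (forall i j, continuous (fun t => SO_mx (f t) i j)) -> continuous f.
Proof. by move=> cf; apply: continuous_comp_initial; exact: continuous_mx. Qed.

Lemma SO_mul_continuous n :
  continuous (fun p : SO R n * SO R n => (p.1 * p.2)%g).
Proof.
apply: continuous_SO => i j.
have -> : (fun p : SO R n * SO R n => SO_mx (p.1 * p.2)%g i j) =
    (fun p => \sum_k SO_mx p.1 i k * SO_mx p.2 k j).
  by apply/funext => p; rewrite /SO_mx /= mxE.
apply: (@continuous_big _ _ _ _ _ add_continuous) => k _ p; apply: continuousM.
  apply: (@continuous_comp _ _ _ fst (fun g => SO_mx g i k)).
    exact: cvg_fst.
  exact: SO_entry_continuous.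
apply: (@continuous_comp _ _ _ snd (fun g => SO_mx g k j)).
  exact: cvg_snd.
exact: SO_entry_continuous.
Qed.

Lemma SO_inv_continuous n : continuous (fun g : SO R n => (g^-1)%g).
Proof.
apply: continuous_SO => i j.
have -> : (fun g : SO R n => SO_mx (g^-1)%g i j) = (fun g => SO_mx g j i).
  by apply/funext => g; rewrite /SO_mx /= mxE.
exact: SO_entry_continuous.
Qed.

HB.instance Definition _ n := isTopologicalGroup.Build (SO R n)
  (@SO_mul_continuous n) (@SO_inv_continuous n).

End special_orthogonal.

Section stabilizer.
Variables (R : realType) (d : nat).

Definition SO_lower : {pred SO R d.+1} :=
  fun g => `[< exists k : SO R d, SO_mx g = lift0_mx (SO_mx k) >].

Lemma SO_lowerP (g : SO R d.+1) :
  reflect (exists k : SO R d, SO_mx g = lift0_mx (SO_mx k)) (g \in SO_lower).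
Proof. exact: asboolP. Qed.

Lemma lift0_mxM (A B : 'M[R]_d) : lift0_mx A *m lift0_mx B = lift0_mx (A *m B).
Proof.
by rewrite /lift0_mx mulmx_block !mul0mx !mulmx0 mul1mx !addr0 !add0r.
Qed.

Lemma SO_lowerM : mulg_closed SO_lower.
Proof.
move=> g h /SO_lowerP[k gk] /SO_lowerP[l hl]; apply/SO_lowerP.
exists (k * l)%g.
by rewrite -[LHS]/(SO_mx g *m SO_mx h) gk hl lift0_mxM.
Qed.

Lemma SO_lower1 : 1%g \in SO_lower.
Proof.
apply/SO_lowerP; exists 1%g.
by rewrite -[LHS]/(1%:M : 'M[R]_(1 + d)%N) /lift0_mx scalar_mx_block.
Qed.

Lemma SO_lowerV : invg_closed SO_lower.
Proof.
move=> g /SO_lowerP[k gk]; apply/SO_lowerP; exists (k^-1)%g.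
rewrite -[LHS]/(SO_mx g)^T gk /lift0_mx.
by rewrite (@tr_block_mx _ 1 d 1 d) trmx1 !trmx0.
Qed.

HB.instance Definition _ := isMulClosed.Build _ SO_lower SO_lowerM.
HB.instance Definition _ := isMul1Closed.Build _ SO_lower SO_lower1.
HB.instance Definition _ := isInvClosed.Build _ SO_lower SO_lowerV.

End stabilizer.

Definition sphere_set (R : realType) n : set 'cV[R]_n :=
  [set x | \sum_i x i 0 ^+ 2 = 1].

Arguments sphere_set : clear implicits.

(* [sphere R d] is the unit sphere S^d of R^(d+1). *)
Definition sphere (R : realType) d : Type := set_type (sphere_set R d.+1).

Section sphere.
Variables (R : realType) (d : nat).

HB.instance Definition _ := SubType.copy (sphere R d) (set_type (sphere_set R d.+1)).
HB.instance Definition _ := Choice.copy (sphere R d) (set_type (sphere_set R d.+1)).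
HB.instance Definition _ :=
  Topological.copy (sphere R d) (set_type (sphere_set R d.+1)).

Definition sphere_vec (x : sphere R d) : 'cV[R]_d.+1 := val x.

Definition e1 : 'cV[R]_d.+1 := delta_mx 0 0.

Lemma sqnormE n (x : 'cV[R]_n) : (x^T *m x) 0 0 = \sum_i x i 0 ^+ 2.
Proof. by rewrite mxE; apply: eq_bigr => i _; rewrite mxE expr2. Qed.

Lemma e1_sphere : sphere_set R d.+1 e1.
Proof.
rewrite /sphere_set /= (bigD1 0) //= big1 ?addr0 ?mxE ?expr1n // => i i0.
by rewrite mxE (negbTE i0) /= expr0n.
Qed.

Lemma SO_sphere (g : SO R d.+1) (x : sphere R d) :
  sphere_set R d.+1 (SO_mx g *m sphere_vec x).
Proof.
rewrite /sphere_set /= -sqnormE trmx_mul -mulmxA (mulmxA (SO_mx g)^T).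
by rewrite SO_trmxK mul1mx sqnormE; exact: (set_mem (valP x)).
Qed.

Definition sphere_e1 : sphere R d := exist _ e1 (mem_set e1_sphere).

HB.instance Definition _ := isPointed.Build (sphere R d) sphere_e1.

Definition sphere_act (g : SO R d.+1) (x : sphere R d) : sphere R d :=
  exist _ (SO_mx g *m sphere_vec x) (mem_set (SO_sphere g x)).

Definition coset_sphere (x : coset_space (@SO_lower R d)) : sphere R d :=
  sphere_act (repr x) sphere_e1.

(* The total mass is left free: it is absorbed by the normalizing constants. *)
Definition uniform_measure (dx : {measure set (borel (sphere R d)) -> \bar R}) :
    Prop :=
  [/\ radon dx, dx setT != 0%E
    & forall g (B : set (borel (sphere R d))), measurable B ->
        pushforward dx (sphere_act g : borel (sphere R d) -> borel _) B = dx B].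

End sphere.

Definition Sym (R : realType) n : {vspace 'M[R]_n} :=
  fixedSpace (linfun (@trmx R n n)).

Section fisher_bingham.
Variables (R : realType) (d : nat).
Local Notation n := d.+1.

Lemma SymP (S : 'M[R]_n) : reflect (S^T = S) (S \in Sym R n).
Proof. by apply: (iffP fixedSpaceP); rewrite lfunE. Qed.

Lemma conj_Sym (g : SO R n) (S : subvs_of (Sym R n)) :
  SO_mx g *m vsval S *m (SO_mx g)^T \in Sym R n.
Proof.
apply/SymP; rewrite !trmx_mul trmxK mulmxA.
by rewrite (SymP _ (subvsP S)).
Qed.

Definition FB_space : vectType R := ('cV[R]_n * subvs_of (Sym R n))%type.

Definition FB_rep (g : SO R n) (w : FB_space) : FB_space :=
  (SO_mx g *m w.1, Subvs (conj_Sym g w.2)).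

Lemma E11_Sym : delta_mx 0 0 \in Sym R n.
Proof. by apply/SymP; rewrite trmx_delta. Qed.

Definition FB_vec : FB_space := (e1 R d, Subvs E11_Sym).

Definition FB_weight (mu : 'cV[R]_n) (A : subvs_of (Sym R n))
    (x : borel (sphere R d)) : R :=
  let v := sphere_vec x in
  expR (- (mu^T *m v) 0 0 - (v^T *m vsval A *m v) 0 0).

Definition fisher_bingham (dx : {measure set (borel (sphere R d)) -> \bar R}) :
    set (probability (borel (sphere R d)) R) :=
  [set p | exists w : FB_space, has_density dx (FB_weight w.1 w.2) p].

End fisher_bingham.

(* Main.v *)
(* The map g |-> g e_1 identifies SO(n)/SO(n-1) with the sphere: a product of two
   reflections gives an explicit continuous local section at e_1, translated by
   SO(n) elsewhere.  Any character in W_0 descends to a continuous function on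
   the compact sphere, so it is bounded and hence zero, and for the same reason
   the multiplier chi of a relatively invariant measure is 1.  Pushed to the
   sphere, such a measure is therefore invariant, and it is a multiple of dx by
   Christensen's argument: if caps of a given radius all have mass g(r) for mu
   and h(r) for nu, Fubini gives g(r) nu(S) = h(r) mu(S), and Fatou applied to
   x |-> nu(U \cap B(x,r)) / h(r), which tends to 1 on an open set U, gives
   mu(U) <= (mu(S) / nu(S)) nu(U).  Finally the linear forms on R^n + Sym(n)
   evaluated at (x, x x^T) are exactly the functions mu^T x + x^T A x. *)
From HB Require Import structures.
Require Import Defs.
From mathcomp Require Import all_boot all_order all_algebra.
From mathcomp Require Import all_classical all_reals all_analysis.
From mathcomp Require Import finmap ring lra measurable_realfun.

Set Implicit Arguments.
Unset Strict Implicit.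
Unset Printing Implicit Defensive.
Import Order.TTheory GRing.Theory Num.Theory.
Import numFieldNormedType.Exports.

Local Open Scope classical_set_scope.
Local Open Scope ring_scope.

(** * Reflections and the action of SO(n) on the sphere *)

Lemma det_sub_rank1 (R : comNzRingType) n (u : 'cV[R]_n) (v : 'rV[R]_n) :
  \det (1%:M - u *m v) = 1 - (v *m u) 0 0.
Proof.
(* Two factorizations of [[1, v], [u, 1]]. *)
have E1 : block_mx 1%:M 0 u 1%:M *m block_mx 1%:M v 0 (1%:M - u *m v)
    = block_mx (1%:M : 'M[R]_1) v u 1%:M.
  rewrite mulmx_block !mul1mx !mulmx1 !mul0mx !addr0.
  by congr block_mx; rewrite addrC subrK.
have E2 : block_mx (1%:M - v *m u) v 0 1%:M *m block_mx 1%:M 0 u 1%:M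
    = block_mx (1%:M : 'M[R]_1) v u 1%:M.
  by rewrite mulmx_block !mulmx1 !mul1mx !mulmx0 !add0r subrK.
have := congr1 determinant (etrans E1 (esym E2)).
rewrite !det_mulmx !det_lblock !det_ublock !det1 !mulr1 !mul1r => ->.
by rewrite det_mx11 !mxE eqxx.
Qed.

Section reflections.
Variables (R : realType) (n : nat).
Implicit Types u x y : 'cV[R]_n.

Definition dotp x y : R := (x^T *m y) 0 0.

Lemma dotpE x y : dotp x y = \sum_i x i 0 * y i 0.
Proof. by rewrite /dotp mxE; apply: eq_bigr => i _; rewrite mxE. Qed.

Lemma dotpC x y : dotp x y = dotp y x.
Proof. by rewrite !dotpE; apply: eq_bigr => i _; rewrite mulrC. Qed.

Lemma dotpDl x y u : dotp (x + y) u = dotp x u + dotp y u.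
Proof. by rewrite /dotp linearD mulmxDl mxE. Qed.

Lemma dotpDr x y u : dotp u (x + y) = dotp u x + dotp u y.
Proof. by rewrite dotpC dotpDl !(dotpC u). Qed.

Lemma dotp_scalar x y : x^T *m y = (dotp x y)%:M.
Proof. exact: mx11_scalar. Qed.

Lemma dotp_eq0 u : (dotp u u == 0) = (u == 0).
Proof.
apply/idP/eqP => [|->]; last by rewrite /dotp mulmx0 mxE.
rewrite dotpE psumr_eq0 => [/allP u0|i _]; last by rewrite -expr2 sqr_ge0.
apply/colP => i; rewrite mxE; apply/eqP.
by have := u0 i (mem_index_enum i); rewrite -expr2 sqrf_eq0.
Qed.

(** The Householder reflection in the hyperplane orthogonal to [u]; at [u = 0] the division by zero
    makes it the identity. *)
Definition reflection u : 'M[R]_n := 1%:M - (2 / dotp u u) *: (u *m u^T).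

Lemma reflectionE u x : reflection u *m x = x - (2 * dotp u x / dotp u u) *: u.
Proof.
rewrite mulmxBl mul1mx -scalemxAl -mulmxA dotp_scalar mul_mx_scalar scalerA.
by rewrite mulrAC.
Qed.

Lemma reflection_tr u : (reflection u)^T = reflection u.
Proof. by rewrite linearB /= trmx1 linearZ /= trmx_mul trmxK. Qed.

Lemma reflectionK u : u != 0 -> reflection u *m reflection u = 1%:M.
Proof.
rewrite -dotp_eq0 => u0; rewrite {2}/reflection mulmxBr mulmx1 -scalemxAr mulmxA.
rewrite reflectionE mulfK // [2 *: u]scaler_nat mulr2n opprD addNKr mulNmx.
by rewrite scalerN opprK subrK.
Qed.

Lemma det_reflection u : u != 0 -> \det (reflection u) = -1.
Proof.
rewrite -dotp_eq0 => u0; rewrite /reflection scalemxAl det_sub_rank1.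
by rewrite -scalemxAr mxE -/(dotp u u) divfK //; ring.
Qed.

Lemma SO_reflections u x : u != 0 -> x != 0 ->
  SO_set R n (reflection u *m reflection x).
Proof.
move=> u0 x0; split; last by rewrite det_mulmx !det_reflection // mulrNN mulr1.
by rewrite trmx_mul !reflection_tr mulmxA -(mulmxA (reflection x)) reflectionK //
  mulmx1 reflectionK.
Qed.

Lemma reflectionN x : x != 0 -> reflection x *m x = - x.
Proof.
rewrite -dotp_eq0 => x0; rewrite reflectionE mulfK // scaler_nat mulr2n.
by rewrite opprD addNKr.
Qed.

(** For vectors of equal length 2<x + y, x> = |x + y|^2, so exactly x + y is subtracted from x.
    Combined with [reflectionN], this yields a rotation taking x to y. *)
Lemma reflection_sum x y : dotp x x = dotp y y -> x + y != 0 ->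
  reflection (x + y) *m x = - y.
Proof.
move=> xy; rewrite -dotp_eq0 => xy0; rewrite reflectionE.
have -> : 2 * dotp (x + y) x = dotp (x + y) (x + y).
  by rewrite !(dotpDl, dotpDr) -xy (dotpC y x); ring.
by rewrite divff // scale1r opprD addNKr.
Qed.

Lemma reflection_orth u x : dotp u x = 0 -> reflection u *m x = x.
Proof. by move=> ux; rewrite reflectionE ux mulr0 mul0r scale0r subr0. Qed.

End reflections.

Section sphere_action.
Variables (R : realType) (d : nat).
Implicit Types (g : SO R d.+1) (x : sphere R d).

Lemma sphere_dotp x : dotp (sphere_vec x) (sphere_vec x) = 1.
Proof. by rewrite /dotp sqnormE; exact: (set_mem (valP x)). Qed.

Lemma sphere_vec_neq0 x : sphere_vec x != 0.
Proof. by rewrite -dotp_eq0 sphere_dotp oner_eq0. Qed.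

Lemma sphere_vec_inj : injective (@sphere_vec R d).
Proof. exact: val_inj. Qed.

Lemma sphere_vec_act g x : sphere_vec (sphere_act g x) = SO_mx g *m sphere_vec x.
Proof. by []. Qed.

Lemma sphere_vec_e1 : sphere_vec (sphere_e1 R d) = e1 R d.
Proof. by []. Qed.

Lemma sphere_actM g h x : sphere_act (g * h)%g x = sphere_act g (sphere_act h x).
Proof. by apply: sphere_vec_inj; rewrite !sphere_vec_act mulmxA. Qed.

Lemma sphere_act1 x : sphere_act 1%g x = x.
Proof. by apply: sphere_vec_inj; rewrite sphere_vec_act mul1mx. Qed.

Lemma sphere_actK g x : sphere_act g^-1%g (sphere_act g x) = x.
Proof. by rewrite -sphere_actM mulVg sphere_act1. Qed.

Lemma sphere_actVK g x : sphere_act g (sphere_act g^-1%g x) = x.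
Proof. by rewrite -sphere_actM mulgV sphere_act1. Qed.

Lemma dotp_act g x y :
  dotp (sphere_vec (sphere_act g x)) (sphere_vec (sphere_act g y))
  = dotp (sphere_vec x) (sphere_vec y).
Proof.
by rewrite !sphere_vec_act /dotp trmx_mul -mulmxA (mulmxA (SO_mx g)^T) SO_trmxK
  mul1mx.
Qed.

(* Only meaningful when [x != - e1]; [insubd] returns [1] otherwise. *)
Definition local_section (x : sphere R d) : SO R d.+1 :=
  insubd (1%g : SO R d.+1)
    (reflection (e1 R d + sphere_vec x) *m reflection (e1 R d)).

Lemma e1_neq0 : e1 R d != 0.
Proof. exact: (sphere_vec_neq0 (sphere_e1 R d)). Qed.

Lemma local_sectionE x : e1 R d + sphere_vec x != 0 ->
  SO_mx (local_section x)
  = reflection (e1 R d + sphere_vec x) *m reflection (e1 R d).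
Proof. by move=> x0; apply: insubdK; apply/mem_set/SO_reflections/e1_neq0. Qed.

(** The reflection in e_1 negates e_1, and the reflection in e_1 + x sends -e_1 to x. *)
Lemma local_sectionK x : e1 R d + sphere_vec x != 0 ->
  sphere_act (local_section x) (sphere_e1 R d) = x.
Proof.
move=> x0; apply: sphere_vec_inj; rewrite sphere_vec_act local_sectionE //.
rewrite -mulmxA reflectionN ?e1_neq0 // mulmxN reflection_sum ?opprK //.
by rewrite sphere_dotp; exact: (sphere_dotp (sphere_e1 R d)).
Qed.

Lemma sphere_transitive x : (0 < d)%N ->
  exists g, sphere_act g (sphere_e1 R d) = x.
Proof.
move=> d0; have [x0|x0] := eqVneq (e1 R d + sphere_vec x) 0; last first.
  by exists (local_section x); exact: local_sectionK.
(* [local_section] misses only x = -e_1. There a basis vector orthogonal to e_1, available since d >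
   0, is used instead: its reflection fixes the vector -e_1 produced by the reflection in e_1. *)
pose u : 'cV[R]_d.+1 := delta_mx ord_max 0.
have u0 : u != 0.
  apply/eqP => /colP/(_ ord_max); rewrite !mxE !eqxx /= => /eqP.
  by rewrite oner_eq0.
have ue1 : dotp u (e1 R d) = 0.
  rewrite /dotp trmx_delta mul_delta_mx_0 ?mxE //.
  by apply/eqP => /(congr1 val) /= dE; rewrite dE in d0.
exists (mkSO (SO_reflections u0 e1_neq0)); apply: sphere_vec_inj.
rewrite sphere_vec_act /SO_mx /= -mulmxA reflectionN ?e1_neq0 //.
rewrite mulmxN reflection_orth //.
by apply/eqP; rewrite -subr_eq0 -opprD oppr_eq0 x0.
Qed.

(** Lets later arguments replace the block form of H by the stabilizer of e_1. If g fixes e_1, so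
    does g^T; hence the first column and the first row of g are those of the identity, and the
    remaining block inherits orthogonality and determinant 1. *)
Lemma SO_lower_stab g :
  (g \in @SO_lower R d) = (sphere_act g (sphere_e1 R d) == sphere_e1 R d).
Proof.
have e1E : e1 R d = col_mx 1%:M 0 :> 'cV[R]_(1 + d).
  apply/colP => i; case: (@split_ordP 1 d i) => j ->.
    by rewrite col_mxEu ord1 !mxE.
  by rewrite col_mxEd !mxE.
apply/SO_lowerP/eqP => [[k gk]|/(congr1 (@sphere_vec R d))].
  apply: sphere_vec_inj; rewrite sphere_vec_act gk sphere_vec_e1 e1E /lift0_mx.
  by rewrite (@mul_block_col _ 1 d 1 d) !mul1mx !mul0mx !mulmx0 !addr0.
rewrite sphere_vec_act sphere_vec_e1 => ge1.
have gTe1 : (SO_mx g)^T *m e1 R d = e1 R d.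
  by rewrite -{1}ge1 mulmxA SO_trmxK mul1mx.
have := SO_trmxK g; have := SO_det g; move: ge1 gTe1.
rewrite e1E -[SO_mx g](@submxK _ 1 d 1 d) (@tr_block_mx _ 1 d 1 d).
move: (ulsubmx _) (ursubmx _) (dlsubmx _) (drsubmx _) => a b c D.
rewrite (@mulmx_block _ 1 d 1 d 1 d) !(@mul_block_col _ 1 d 1 d).
rewrite !mulmx1 !mulmx0 !addr0.
move=> /(@eq_col_mx _ 1 d)[-> ->] /(@eq_col_mx _ 1 d)[_ /(congr1 trmx)].
rewrite trmxK trmx0 => ->; rewrite (@det_lblock _ 1 d) det1 mul1r => detD.
rewrite [RHS](@scalar_mx_block _ 1 d).
move=> /(@eq_block_mx _ 1 d 1 d)[_ _ _]; rewrite mulmx0 add0r => DD.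
by exists (mkSO (conj DD detD)).
Qed.

End sphere_action.

(** * The homeomorphism with the sphere *)

Lemma coset_piP (G : topGroupType) (H : groupClosed G) (g h : G) :
  reflect (coset_pi H g = coset_pi H h) ((g^-1 * h)%g \in H).
Proof. exact: (@eqmodP _ (same_coset_equiv H) g h). Qed.

Lemma coset_piK (G : topGroupType) (H : groupClosed G) (x : coset_space H) :
  coset_pi H (repr x) = x.
Proof. exact: reprK. Qed.

Section continuity.
Variables (R : realType).

(** Pointwise counterpart of [continuous_SO]: [local_section] is shown continuous only at e_1. *)
Lemma SO_cvg n (T : topologicalType) (f : T -> SO R n) (t : T) :
  (forall i j, {for t, continuous (fun s => SO_mx (f s) i j)}) ->
  {for t, continuous f}.
Proof.
move=> cf; have cmx : {for t, continuous (fun s => SO_mx (f s))}.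
  move=> A [P Pt PA]; rewrite nbhs_simpl.
  have : \forall s \near t, forall ij : 'I_n * 'I_n,
      P ij.1 ij.2 (SO_mx (f s) ij.1 ij.2).
    by apply: filter_forall => -[i j]; exact: cf.
  by apply: filterS => s Ps; apply: PA => i j; exact: (Ps (i, j)).
move=> U [?/= [[W oW <-]]] /= Wsfz /filterS; apply; apply: cmx.
exact: open_nbhs_nbhs.
Qed.

Lemma continuous_sumr_at (T : topologicalType) (t : T) n (f : 'I_n -> T -> R) :
  (forall k, {for t, continuous (f k)}) ->
  {for t, continuous (fun s => \sum_k f k s)}.
Proof.
move=> cf; apply: (@cvg_big _ _ _ _ _ add_continuous) => k _; exact: cf.
Qed.

Variable d : nat.

Lemma sphere_coord_continuous (i : 'I_d.+1) :
  continuous (fun x : sphere R d => sphere_vec x i 0).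
Proof.
move=> x; apply: (@continuous_comp _ _ _ (@sphere_vec R d) (fun M => M i 0)).
  exact: initial_continuous.
exact: coord_continuous.
Qed.

Lemma continuous_sphere (T : topologicalType) (f : T -> sphere R d) :
  (forall i, continuous (fun t => sphere_vec (f t) i 0)) -> continuous f.
Proof.
move=> cf; apply: continuous_comp_initial; apply: continuous_mx => i j.
by rewrite ord1; exact: cf.
Qed.

Lemma sphere_act_continuous g : continuous (@sphere_act R d g).
Proof.
apply: continuous_sphere => i.
under eq_fun do rewrite sphere_vec_act mxE.
apply: (@continuous_big _ _ _ _ _ add_continuous) => k _ p; apply: continuousM.
  exact: cst_continuous.
exact: sphere_coord_continuous.
Qed.

Lemma orbit_continuous x : continuous (fun g => @sphere_act R d g x).
Proof.
apply: continuous_sphere => i.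
under eq_fun do rewrite sphere_vec_act mxE.
apply: (@continuous_big _ _ _ _ _ add_continuous) => k _ p; apply: continuousM.
  exact: SO_entry_continuous.
exact: cst_continuous.
Qed.

Lemma sphere_dotp_continuous (v : 'cV[R]_d.+1) :
  continuous (fun x : sphere R d => dotp v (sphere_vec x)).
Proof.
under eq_fun do rewrite dotpE.
apply: (@continuous_big _ _ _ _ _ add_continuous) => k _ p; apply: continuousM.
  exact: cst_continuous.
exact: sphere_coord_continuous.
Qed.

Lemma open_cap (v : 'cV[R]_d.+1) (t : R) :
  open [set x : sphere R d | t < dotp v (sphere_vec x)].
Proof.
by move/continuousP: (@sphere_dotp_continuous v) => /(_ _ (@open_gt _ t)).
Qed.

Lemma e1_add_neq0 (x : sphere R d) :
  dotp (e1 R d) (sphere_vec x) != -1 -> e1 R d + sphere_vec x != 0.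
Proof.
apply: contra => /eqP /(congr1 (dotp (e1 R d))).
rewrite dotpDr (sphere_dotp (sphere_e1 R d)) {2}/dotp mulmx0 mxE => /eqP.
by rewrite addrC addr_eq0.
Qed.

Lemma near_e1 : \forall x \near (sphere_e1 R d : sphere R d),
  e1 R d + sphere_vec x != 0.
Proof.
apply: filterS (open_nbhs_nbhs (conj (open_cap (e1 R d) 0) _)) => [x /= x0|/=].
  by apply: e1_add_neq0; rewrite gt_eqF // (lt_trans _ x0) // ltrN10.
by rewrite (sphere_dotp (sphere_e1 R d)).
Qed.

(** Near e_1 the entries of the section are rational in the coordinates of x, with denominator |e_1
    + x|^2, which is nonzero at x = e_1. *)
Lemma local_section_continuous :
  {for sphere_e1 R d, continuous (@local_section R d)}.
Proof.
pose u (x : sphere R d) := e1 R d + sphere_vec x.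
have cu i : continuous (fun x => u x i 0).
  under eq_fun do rewrite mxE.
  move=> x; apply: continuousD; first exact: cst_continuous.
  exact: sphere_coord_continuous.
apply: SO_cvg => i j.
pose F (x : sphere R d) := (reflection (e1 R d + sphere_vec x) *m
  reflection (e1 R d)) i j.
have nearF : \forall x \near (sphere_e1 R d : sphere R d),
    F x = SO_mx (local_section x) i j.
  by apply: filterS near_e1 => x x0; rewrite local_sectionE.
suff cF : {for sphere_e1 R d, continuous F}.
  rewrite /prop_for /continuous_at -(nbhs_singleton nearF).
  by apply: cvg_trans cF; exact: near_eq_cvg nearF.
have e0 : e1 R d + e1 R d != 0.
  exact: (nbhs_singleton near_e1).
have -> : F = fun x => \sum_k (1%:M i k - 2 / dotp (u x) (u x) *
    (u x i 0 * u x k 0)) * reflection (e1 R d) k j.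
  apply/funext => x; rewrite /F mxE; apply: eq_bigr => k _; congr (_ * _).
  by rewrite !mxE big_ord1 !mxE.
apply: continuous_sumr_at => k.
apply: continuousM; last exact: cst_continuous.
apply: continuousB; first exact: cst_continuous.
apply: continuousM; last by apply: continuousM; exact: cu.
apply: continuousM; first exact: cst_continuous.
apply: continuousV; first by rewrite dotp_eq0.
have -> : (fun x => dotp (u x) (u x)) = fun x => \sum_l u x l 0 * u x l 0.
  by apply/funext => x; rewrite dotpE.
by apply: continuous_sumr_at => l; apply: continuousM; apply: cu.
Qed.

(** [coset_sphere] goes through a chosen representative; another one differs by a right factor in H,
    which fixes e_1. *)
Lemma coset_sphereE g :
  coset_sphere (coset_pi (@SO_lower R d) g) = sphere_act g (sphere_e1 R d).
Proof.
rewrite /coset_sphere; set r := repr _.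
have /esym/coset_piP : coset_pi (@SO_lower R d) r = coset_pi (@SO_lower R d) g.
  exact: coset_piK.
rewrite SO_lower_stab sphere_actM => /eqP e.
by rewrite -[LHS](sphere_actVK g) e.
Qed.

Lemma coset_sphere_continuous : continuous (@coset_sphere R d).
Proof.
apply/quotient_continuous.
have -> : @coset_sphere R d \o \pi_(coset_space (@SO_lower R d))%qT =
    fun g => sphere_act g (sphere_e1 R d).
  by apply/funext => g; exact: coset_sphereE.
exact: orbit_continuous.
Qed.

Lemma coset_sphere_inj : injective (@coset_sphere R d).
Proof.
move=> x y; rewrite -[x]coset_piK -[y]coset_piK !coset_sphereE => e.
by apply/coset_piP; rewrite SO_lower_stab sphere_actM -e sphere_actK.
Qed.

Hypothesis d0 : (0 < d)%N.

(** The group element is an arbitrary choice, possibly discontinuous in x; [coset_pi] forgets it,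
    and continuity is recovered afterwards. *)
Definition sphere_coset (x : sphere R d) : coset_space (@SO_lower R d) :=
  coset_pi (@SO_lower R d) (projT1 (cid (sphere_transitive x d0))).

Lemma sphere_cosetK : cancel sphere_coset (@coset_sphere R d).
Proof.
by move=> x; rewrite coset_sphereE; exact: (projT2 (cid (sphere_transitive x d0))).
Qed.

Lemma coset_sphereK : cancel (@coset_sphere R d) sphere_coset.
Proof. by move=> x; apply: coset_sphere_inj; rewrite sphere_cosetK. Qed.

Lemma sphere_coset_act g :
  sphere_coset (sphere_act g (sphere_e1 R d)) = coset_pi (@SO_lower R d) g.
Proof. by rewrite -coset_sphereE coset_sphereK. Qed.

Lemma sphere_coset_continuous : continuous sphere_coset.
Proof.
move=> x; have [g gx] := sphere_transitive x d0.
(* Near x = g e_1 the inverse map is y |-> g s(g^-1 y) H, where the section s is continuous at g^-1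
   x = e_1. *)
pose F y := coset_pi (@SO_lower R d) (g * local_section (sphere_act g^-1%g y))%g.
have gVx : sphere_act g^-1%g x = sphere_e1 R d by rewrite -gx sphere_actK.
have nearF : \forall y \near x, F y = sphere_coset y.
  have : \forall y \near x, e1 R d + sphere_vec (sphere_act g^-1%g y) != 0.
    have := @sphere_act_continuous g^-1%g x; rewrite /continuous_at gVx.
    by move=> /(_ _ near_e1).
  apply: filterS => y y0; rewrite /F -sphere_coset_act sphere_actM.
  by rewrite local_sectionK // sphere_actVK.
suff cF : {for x, continuous F}.
  rewrite /continuous_at -(nbhs_singleton nearF).
  by apply: cvg_trans cF; exact: near_eq_cvg nearF.
apply: (@continuous_comp _ _ _ (fun y => g * local_section (sphere_act g^-1%g y))%g
    (coset_pi (@SO_lower R d))).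
  apply: (@continuous_comp _ _ _ (fun y => (g, local_section (sphere_act g^-1%g y)))
    (fun p => (p.1 * p.2)%g)); last exact: mulg_continuous.
  have c1 : {for x, continuous (fun y => local_section (sphere_act g^-1%g y))}.
    apply: (@continuous_comp _ _ _ (sphere_act g^-1%g) (@local_section R d)).
      exact: sphere_act_continuous.
    by rewrite gVx; exact: local_section_continuous.
  exact: (cvg_pair (@cst_continuous _ _ g x) c1).
exact: pi_continuous.
Qed.

End continuity.

(** * Compactness of the sphere *)

Section sphere_geometry.
Variables (R : realType) (d : nat).
Implicit Types x y : sphere R d.

Lemma sphere_dist2 x y :
  \sum_i (sphere_vec x i 0 - sphere_vec y i 0) ^+ 2
  = 2 - 2 * dotp (sphere_vec x) (sphere_vec y).
Proof.
have := sphere_dotp x; have := sphere_dotp y; rewrite !dotpE => ny nx.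
rewrite (eq_bigr (fun i => sphere_vec x i 0 * sphere_vec x i 0
  + sphere_vec y i 0 * sphere_vec y i 0
  - 2 * (sphere_vec x i 0 * sphere_vec y i 0))); last by move=> i _; ring.
by rewrite sumrB big_split /= nx ny -mulr_sumr.
Qed.

Lemma sphere_dotp_eq1 x y :
  (dotp (sphere_vec x) (sphere_vec y) == 1) = (x == y).
Proof.
apply/eqP/eqP => [xy|->]; last exact: sphere_dotp.
have := sphere_dist2 x y; rewrite xy mulr1 subrr => /eqP.
rewrite psumr_eq0 => [/allP e|i _]; last exact: sqr_ge0.
apply/sphere_vec_inj/colP => i; apply/eqP; rewrite -subr_eq0.
by have := e i (mem_index_enum i); rewrite sqrf_eq0.
Qed.

Lemma open_contains_cap (U : set (sphere R d)) x : open U -> U x ->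
  exists2 t, t < 1 &
    [set y | t < dotp (sphere_vec x) (sphere_vec y)] `<=` U.
Proof.
case=> O oO <- Ox.
have [e e0 eO] : exists2 e : R, 0 < e & ball (sphere_vec x) e `<=` O.
  by have /nbhs_ballP[e e0 eO] := open_nbhs_nbhs (conj oO Ox); exists e.
(* As |x - y|^2 = 2 - 2<x, y>, this threshold gives |x - y| < e, hence |x_i - y_i| < e for each
   coordinate, which is what the sup-norm ball asks. *)
exists (1 - e ^+ 2 / 2) => [|y /= ty].
  by rewrite ltrBlDr ltrDl divr_gt0 // exprn_gt0.
apply: eO; split=> // i j; rewrite ord1 /ball /=.
rewrite -ltr_sqr ?nnegrE ?(ltW e0) // real_normK ?num_real //.
apply: le_lt_trans (_ : 2 - 2 * dotp (sphere_vec x) (sphere_vec y) < _).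
  rewrite -sphere_dist2 (bigD1 i) //= lerDl.
  by apply: sumr_ge0 => k _; exact: sqr_ge0.
by move: ty; lra.
Qed.

Lemma sphere_compact : compact [set: sphere R d].
Proof.
(* [bounded_closed_compact] concerns row vectors, so unit rows are treated first and the sphere is
   obtained as their image under transposition. *)
pose K := [set v : 'rV[R]_d.+1 | dotp v^T v^T = 1].
have cK : compact K.
  apply: bounded_closed_compact.
    exists 1; split=> // M M1 v /= Kv; rewrite (le_trans _ (ltW M1)) //.
    rewrite [leLHS]mx_normrE; apply: bigmax_le => // -[i j] _ /=.
    rewrite ord1 -(@ler_sqr R) ?nnegrE // real_normK ?num_real // expr1n -Kv.
    rewrite dotpE (bigD1 j) //= !mxE -expr2 lerDl.
    by apply: sumr_ge0 => k _; rewrite mxE -expr2 sqr_ge0.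
  have -> : K = (fun v : 'rV[R]_d.+1 => \sum_i v 0 i * v 0 i) @^-1` [set 1].
    apply/funext => v; rewrite /K /= dotpE; congr (_ = _).
    by apply: eq_bigr => i _; rewrite mxE.
  apply: closed_comp; last exact: closed_eq.
  move=> v _; apply: continuous_sumr_at => i.
  by apply: continuousM; exact: coord_continuous.
have Ksphere (v : 'rV[R]_d.+1) : K v -> v^T \in sphere_set R d.+1.
  by move=> Kv; apply/mem_set; rewrite /sphere_set /= -sqnormE.
(* Off [K] this map takes the default value e_1, so its continuity is proved only within [K]. *)
pose f (v : 'rV[R]_d.+1) : sphere R d := insubd (sphere_e1 R d) v^T.
have fE v : K v -> sphere_vec (f v) = v^T.
  by move=> Kv; apply: insubdK; exact: Ksphere.
have -> : [set: sphere R d] = f @` K.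
  apply/seteqP; split=> // x _; exists (sphere_vec x)^T.
    by rewrite /K /= trmxK sphere_dotp.
  apply: sphere_vec_inj; rewrite fE ?trmxK //.
  by rewrite /K /= trmxK sphere_dotp.
apply: continuous_compact => //.
apply: continuous_comp_initial.
apply: (@subspace_eq_continuous _ _ _ (fun v : 'rV[R]_d.+1 => v^T)).
  by move=> v /set_mem Kv; rewrite /= -fE.
apply: continuous_subspaceT; apply: continuous_mx => i j v.
have -> : (fun t : 'rV[R]_d.+1 => t^T i j) = fun t => t j i.
  by apply/funext => t; rewrite mxE.
exact: coord_continuous.
Qed.

(** By the equality case <x, y> = 1 iff x = y on the sphere, H is the preimage of 1 under the
    continuous function g |-> <e_1, g e_1>. *)
Lemma SO_lower_closed : closed [set g : SO R d.+1 | g \in @SO_lower R d].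
Proof.
have -> : [set g : SO R d.+1 | g \in @SO_lower R d] =
    (fun g => dotp (sphere_vec (sphere_e1 R d))
      (sphere_vec (sphere_act g (sphere_e1 R d)))) @^-1` [set 1].
  apply/seteqP; split=> g /=; rewrite SO_lower_stab eq_sym -sphere_dotp_eq1.
    by move/eqP.
  by move->.
apply: closed_comp; last exact: closed_eq.
move=> g _; apply: (@continuous_comp _ _ _ (fun g => sphere_act g (sphere_e1 R d))
  (fun x => dotp _ (sphere_vec x))).
  exact: orbit_continuous.
exact: sphere_dotp_continuous.
Qed.

Lemma W0_SO (tau : SO R d.+1 -> R) : (0 < d)%N ->
  W0 (@SO_lower R d) tau -> forall g, tau g = 0.
Proof.
move=> d0 [ctau tauM tauH] g0.
have tau_coset g h : coset_pi (@SO_lower R d) g = coset_pi (@SO_lower R d) h ->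
    tau g = tau h.
  move/coset_piP/tauH => e; rewrite -[h](mulVKg g) tauM e addr0 //.
pose f x := tau (repr (sphere_coset d0 x)).
have cf : continuous f.
  move=> x; apply: (@continuous_comp _ _ _ (sphere_coset d0) (tau \o repr)).
    exact: sphere_coset_continuous.
  apply: repr_comp_continuous => // g h /eqP gh.
  by apply/eqP; exact: tau_coset.
have [M [_ Mb]] : bounded_set (range f).
  apply: compact_bounded; apply: continuous_compact; last exact: sphere_compact.
  exact: continuous_subspaceT.
have tauB g : `|tau g| <= M + 1.
  apply: (Mb (M + 1)); first by rewrite ltrDl.
  exists (coset_sphere (coset_pi (@SO_lower R d) g)) => //.
  by apply: tau_coset; rewrite coset_piK coset_sphereK.
have tauX n : tau (g0 ^+ n)%g = tau g0 *+ n.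
  elim: n => [|n IH]; last by rewrite expgSr tauM IH mulrSr.
  by rewrite mulr0n; apply: (addrI (tau 1%g)); rewrite -tauM mulg1 addr0.
apply/eqP; rewrite -normr_le0 leNgt; apply/negP => t0.
(* The exponent n exceeds (M + 1) / |tau g0|, so |tau(g0^n)| = n |tau g0| breaks the bound
   [tauB]. *)
have := tauB (g0 ^+ (Num.trunc ((M + 1) / `|tau g0|)).+1)%g.
rewrite tauX normrMn leNgt -mulr_natr mulrC -ltr_pdivrMr //.
by rewrite truncnS_gt.
Qed.

End sphere_geometry.

(** * Linear forms on the representation *)

Lemma mulmx_entry_continuous (R : realType) (T : topologicalType) m n p
    (f : T -> 'M[R]_(m, n)) (g : T -> 'M[R]_(n, p)) :
  (forall i j, continuous (fun t => f t i j)) ->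
  (forall i j, continuous (fun t => g t i j)) ->
  forall i j, continuous (fun t => (f t *m g t) i j).
Proof.
move=> cf cg i j; under eq_fun do rewrite mxE.
move=> t; apply: continuous_sumr_at => k.
by apply: continuousM; [exact: cf|exact: cg].
Qed.

Section fisher_bingham_representation.
Variables (R : realType) (d : nat).
Local Notation n := d.+1.
Local Notation SymT := (subvs_of (Sym R n)).

Lemma FB_eq (u v : FB_space R d) :
  u.1 = v.1 -> vsval u.2 = vsval v.2 -> u = v.
Proof. by case: u v => [u1 u2] [v1 v2] /= -> /val_inj ->. Qed.

(** The trace pairing tr(A^T S). *)
Definition frob (A S : 'M[R]_n) : R := \sum_i \sum_j A i j * S i j.

Lemma frob_outer (A : 'M[R]_n) (x : 'cV[R]_n) :
  frob A (x *m x^T) = (x^T *m A *m x) 0 0.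
Proof.
rewrite mxE /frob exchange_big /=; apply: eq_bigr => j _.
rewrite mxE mulr_suml; apply: eq_bigr => i _.
by rewrite !mxE big_ord1 !mxE; ring.
Qed.

(** Since E_11 = e_1 e_1^T, conjugation by g gives (g e_1)(g e_1)^T; the orbit of v_0 thus consists
    of the pairs (x, x x^T). *)
Lemma FB_rep_vec (g : SO R n) :
  let x := sphere_vec (sphere_act g (sphere_e1 R d)) in
  (FB_rep g (FB_vec R d)).1 = x /\ vsval (FB_rep g (FB_vec R d)).2 = x *m x^T.
Proof.
split=> //=; rewrite sphere_vec_act sphere_vec_e1 trmx_mul.
rewrite -!mulmxA; congr (_ *m _); rewrite !mulmxA; congr (_ *m _).
by rewrite trmx_delta mul_delta_mx.
Qed.

Lemma sym_unit_Sym (i j : 'I_n) :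
  2^-1 *: (delta_mx i j + delta_mx j i : 'M[R]_n) \in Sym R n.
Proof. by apply/SymP; rewrite linearZ /= linearD /= !trmx_delta addrC. Qed.

Definition sym_unit i j : SymT := Subvs (sym_unit_Sym i j).

(** The family [sym_unit] is redundant, as (i, j) and (j, i) give the same element, but its
    coefficients are simply the entries of S. The identity is the average of the matrix-unit
    expansions of S and S^T. *)
Lemma sum_sym_unit (S : SymT) : S = \sum_i \sum_j vsval S i j *: sym_unit i j.
Proof.
apply: val_inj; rewrite linear_sum /=.
have ES : vsval S = \sum_i \sum_j vsval S i j *: delta_mx i j.
  exact: matrix_sum_delta.
have ET : vsval S = \sum_i \sum_j vsval S i j *: delta_mx j i.
  rewrite -[LHS](SymP _ (subvsP S)) [in LHS]ES linear_sum /=.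
  apply: eq_bigr => i _.
  by rewrite linear_sum /=; apply: eq_bigr => j _; rewrite linearZ /= trmx_delta.
transitivity (2^-1 *: (vsval S + vsval S)).
  by rewrite scalerDr -scalerDl -[2^-1]div1r -splitr scale1r.
rewrite (congr2 +%R ES ET) -big_split scaler_sumr; apply: eq_bigr => i _ /=.
rewrite linear_sum -big_split scaler_sumr; apply: eq_bigr => j _ /=.
by rewrite linearZ /= -scalerDr !scalerA mulrC.
Qed.

Section functional_coordinates.
Variable phi : 'Hom(FB_space R d, R^o).

Definition functional_vec : 'cV[R]_n :=
  \col_i (phi (delta_mx i 0, 0 : SymT) : R).

Definition functional_mx : 'M[R]_n :=
  \matrix_(i, j) (phi (0 : 'cV[R]_n, sym_unit i j) : R).

Lemma functional_mx_Sym : functional_mx \in Sym R n.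
Proof.
apply/SymP/matrixP => i j; rewrite !mxE; congr (phi (_, _)).
by apply: val_inj; rewrite /= addrC.
Qed.

(** The vectors (e_i, 0) and (0, [sym_unit i j]) span the representation space, so the values of phi
    on them determine it; this turns phi into a Fisher-Bingham parameter. *)
Lemma functionalE (w : FB_space R d) :
  phi w = dotp functional_vec w.1 + frob functional_mx (vsval w.2) :> R.
Proof.
have vecE (v : 'cV[R]_n) : (v, 0 : SymT) =
    \sum_i v i 0 *: (delta_mx i 0, 0 : SymT).
  apply: FB_eq.
    rewrite [RHS](raddf_sum fst) {1}[v]matrix_sum_delta.
    by apply: eq_bigr => i _; rewrite big_ord1.
  by rewrite [in RHS](raddf_sum snd) big1 // => i _ /=; rewrite scaler0.
have symE (S : SymT) : (0 : 'cV[R]_n, S) =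
    \sum_i \sum_j vsval S i j *: (0 : 'cV[R]_n, sym_unit i j).
  apply: FB_eq.
    rewrite [RHS](raddf_sum fst) big1 // => i _.
    by rewrite (raddf_sum fst) big1 // => j _ /=; rewrite scaler0.
  rewrite (raddf_sum snd) [LHS](congr1 vsval (sum_sym_unit S)); congr vsval.
  by apply: eq_bigr => i _; rewrite (raddf_sum snd).
transitivity (phi ((w.1, 0 : SymT) + (0 : 'cV[R]_n, w.2)) : R).
  by congr (phi _); apply: FB_eq; rewrite /= ?addr0 ?add0r.
rewrite linearD /= vecE symE !linear_sum /= dotpE /frob; congr (_ + _).
  by apply: eq_bigr => i _; rewrite linearZ mxE mulrC.
apply: eq_bigr => i _; rewrite linear_sum; apply: eq_bigr => j _.
by rewrite linearZ mxE mulrC.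
Qed.

End functional_coordinates.

(** The converse direction to [functionalE]: each Fisher-Bingham parameter comes from a linear
    form. *)
Definition FB_functional (mu : 'cV[R]_n) (A : SymT) (w : FB_space R d) : R^o :=
  dotp mu w.1 + frob (vsval A) (vsval w.2).

Lemma FB_functional_linear mu A : linear (FB_functional mu A).
Proof.
move=> a u v; rewrite /FB_functional /dotp /= mulmxDr -scalemxAr !mxE.
have -> : frob (vsval A) (vsval (a *: u.2 + v.2)) =
    a * frob (vsval A) (vsval u.2) + frob (vsval A) (vsval v.2).
  rewrite /frob mulr_sumr -big_split; apply: eq_bigr => i _ /=.
  rewrite mulr_sumr -big_split; apply: eq_bigr => j _ /=.
  by rewrite !mxE; ring.
by rewrite scalerDr addrACA.
Qed.

HB.instance Definition _ mu A :=
  GRing.isLinear.Build R (FB_space R d) R^o _ (FB_functional mu A)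
    (FB_functional_linear mu A).

Lemma FB_continuous_representation : continuous_representation (@FB_rep R d).
Proof.
split.
- move=> g a u v; apply: FB_eq => /=.
    by rewrite linearP.
  by rewrite linearP /= mulmxDl -scalemxAl.
- by move=> v; apply: FB_eq; rewrite /= ?mul1mx // trmx1 mulmx1.
- move=> g h v; apply: FB_eq; rewrite /= ?mulmxA //.
  by rewrite trmx_mul !mulmxA.
(* By [functionalE] the matrix coefficient is a polynomial in the entries of g. *)
- move=> phi v; under eq_fun do rewrite functionalE dotpE /frob.
  have cg i k : continuous (fun g : SO R n => SO_mx g i k).
    exact: SO_entry_continuous.
  have c1 i : continuous (fun g => (FB_rep g v).1 i 0).
    apply: (@mulmx_entry_continuous _ _ _ _ _ (@SO_mx R n) (fun=> v.1)) => // *.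
    exact: cst_continuous.
  have c2 i j : continuous (fun g => vsval (FB_rep g v).2 i j).
    apply: (@mulmx_entry_continuous _ _ _ _ _
      (fun g => SO_mx g *m vsval v.2) (fun g => (SO_mx g)^T)) => k l.
      apply: mulmx_entry_continuous => // *.
      exact: cst_continuous.
    have -> : (fun g => (SO_mx g)^T k l) = (fun g : SO R n => SO_mx g l k).
      by apply/funext => g; rewrite mxE.
    exact: cg.
  move=> g; apply: continuousD; apply: continuous_sumr_at => i.
    by apply: continuousM; [exact: cst_continuous|exact: c1].
  apply: continuous_sumr_at => j.
  by apply: continuousM; [exact: cst_continuous|exact: c2].
Qed.

(** By [FB_rep_vec] the image of v_0 under h depends only on h e_1, which is e_1. *)
Lemma FB_vec_fixed : fixed_by (@SO_lower R d) (@FB_rep R d) (FB_vec R d).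
Proof.
move=> h; rewrite SO_lower_stab => /eqP he.
have [] := FB_rep_vec h; rewrite he => E1 E2.
by apply: FB_eq; rewrite ?E1 ?E2 //= trmx_delta mul_delta_mx.
Qed.

End fisher_bingham_representation.

(** * Uniqueness of invariant measures on the sphere *)

Section borel_continuous.

Lemma borel_open (X : ptopologicalType) (U : set X) :
  open U -> measurable (U : set (borel X)).
Proof. exact: sub_sigma_algebra. Qed.

Lemma borel_continuous (X Y : ptopologicalType) (f : X -> Y) :
  continuous f -> measurable_fun setT (f : borel X -> borel Y).
Proof.
move=> /continuousP cf.
apply: (@measurability _ _ (borel X) (borel Y) _ _ (@open Y) erefl).
by move=> _ [U oU <-]; rewrite setTI; apply: borel_open; exact: cf.
Qed.

(** Separate from [borel_continuous] because R carries its own measurable structure; the check is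
    made on open intervals, which generate it. *)
Lemma borel_continuous_real (R : realType) (X : ptopologicalType) (f : X -> R) :
  continuous f -> measurable_fun setT (f : borel X -> R).
Proof.
move=> /continuousP cf; apply: (measurability _ (RGenOpens.measurableE R)).
move=> _ [_ [a [b ->] <-]]; rewrite setTI; apply: borel_open.
exact/cf/interval_open.
Qed.

End borel_continuous.

Lemma limn_einf_le (R : realType) (u : (\bar R)^nat) (M : \bar R) :
  (forall n, (u n <= M)%E) -> (limn_einf u <= M)%E.
Proof.
move=> uM; rewrite limn_einf_lim; apply: lime_le; first exact: is_cvg_einfs.
apply: nearW => n; apply: le_trans (uM n); apply: ereal_inf_lbound.
by exists n => //=.
Qed.

Lemma fine_measure_gt0 d (T : measurableType d) (R : realType)
    (mu : {finite_measure set T -> \bar R}) :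
  mu setT != 0%E -> 0 < fine (mu setT).
Proof.
by move=> mu0; rewrite fine_gt0 // lt0e mu0 measure_ge0 ltey_eq fin_num_measure.
Qed.

Section uniqueness.
Variables (R : realType) (d : nat).
Hypothesis d0 : (0 < d)%N.
Local Notation S := (borel (sphere R d)).

Definition invariant_measure (mu : set S -> \bar R) :=
  forall g (B : set S), measurable B -> mu (sphere_act g @^-1` B) = mu B.

(* The metric balls of the sphere are the sets [cap t x] with [t < 1], and they
   shrink to [x] as [t] tends to [1]. *)
Definition cap (t : R) (x : sphere R d) : set S :=
  [set y | t < dotp (sphere_vec x) (sphere_vec (y : sphere R d))].

Lemma measurable_cap t x : measurable (cap t x).
Proof. by apply: borel_open; exact: open_cap. Qed.

(** The action preserves inner products and is transitive, so caps with the same threshold are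
    translates of each other. *)
Lemma invariant_cap (mu : set S -> \bar R) t x : invariant_measure mu ->
  mu (cap t x) = mu (cap t (sphere_e1 R d)).
Proof.
move=> imu; have [g <-] := sphere_transitive x d0.
rewrite -(imu g (cap t _)); last exact: measurable_cap.
by congr mu; apply/seteqP; split=> y; rewrite /cap /= dotp_act.
Qed.

Definition cap_graph (t : R) : set (S * S) :=
  [set p | t < dotp (sphere_vec (p.1 : sphere R d)) (sphere_vec (p.2 : sphere R d))].

(** The product carries the product sigma-algebra of the two Borel structures, so measurability is
    derived from the coordinate expansion of the inner product rather than from openness. *)
Lemma measurable_cap_graph t : measurable (cap_graph t).
Proof.
have mf : measurable_fun setT (fun p : S * S =>
    dotp (sphere_vec (p.1 : sphere R d)) (sphere_vec (p.2 : sphere R d))).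
  under eq_fun do rewrite dotpE.
  apply: measurable_sum => i; apply: measurable_funM.
    apply: (@measurableT_comp _ _ _ _ _ _
      (fun x : S => sphere_vec (x : sphere R d) i 0) _ fst) => //.
    by apply: borel_continuous_real; exact: sphere_coord_continuous.
  apply: (@measurableT_comp _ _ _ _ _ _
    (fun x : S => sphere_vec (x : sphere R d) i 0) _ snd) => //.
  by apply: borel_continuous_real; exact: sphere_coord_continuous.
have := mf measurableT `]t, +oo[%classic (measurable_itv _).
rewrite setTI; congr measurable.
by apply/seteqP; split=> p /=; rewrite in_itv /= andbT.
Qed.

(** If one cap were null, all its translates would be, and finitely many of them cover the compact
    sphere. *)
Lemma cap_gt0 (mu : {measure set S -> \bar R}) t : invariant_measure mu ->
  t < 1 -> mu setT != 0%E -> (0 < mu (cap t (sphere_e1 R d)))%E.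
Proof.
move=> imu t1; apply: contraNT; rewrite lt0e measure_ge0 andbT negbK => /eqP m0.
have := @sphere_compact R d; rewrite compact_cover.
move=> /(_ _ setT (cap t))[x _|x _|D _ TD].
- exact: open_cap.
- by exists x => //=; rewrite /cap /= sphere_dotp.
pose P (A : set S) := measurable A /\ mu A = 0%E.
have [mC C0] : P (\big[setU/set0]_(x <- D) cap t x).
  apply: big_ind => [|A B [mA A0] [mB B0]|x _].
  - by split; rewrite ?measure0.
  - by split; [exact: measurableU|rewrite measureU0].
  - by split; [exact: measurable_cap|rewrite invariant_cap].
rewrite -measure_le0 -[leRHS]C0.
apply: le_measure; [exact: mem_set|exact: mem_set|].
by move=> y /TD[x /= xD ty]; rewrite -bigcup_seq; exists x.
Qed.

Section comparison.
Variables mu nu : {finite_measure set S -> \bar R}.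
Hypotheses (imu : invariant_measure mu) (inu : invariant_measure nu).
Hypothesis nu0 : nu setT != 0%E.

Let e := sphere_e1 R d.

(** Fubini-Tonelli for the set of (x, y) with y in U and t < <x, y>: the sections at fixed x give
    the left side, and those at fixed y in U are caps around y, all of the same mass for mu. *)
Lemma double_cap t (U : set S) : measurable U ->
  (\int[mu]_x nu (U `&` cap t x) = mu (cap t e) * nu U)%E.
Proof.
move=> mU.
pose A := cap_graph t `&` (setT `*` U).
have mA : measurable A.
  by apply: measurableI; [exact: measurable_cap_graph|exact: measurableX].
have := indic_fubini_tonelli mu nu mA.
rewrite indic_fubini_tonelli_FE // indic_fubini_tonelli_GE //.
have -> : (nu \o xsection A) = fun x => nu (U `&` cap t x).
  apply/funext => x /=; congr (nu _); rewrite xsectionE; apply/seteqP.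
  by split=> y; rewrite /A /cap_graph /cap /=; tauto.
move=> ->.
have -> : (mu \o ysection A) = fun y => (mu (cap t e) * (\1_U y)%:E)%E.
  apply/funext => y /=; rewrite indicE; have [yU|yU] := boolP (y \in U).
    rewrite mule1 -(invariant_cap t y imu); congr (mu _); rewrite ysectionE.
    apply/seteqP.
    move/set_mem: yU => yU.
    by split=> x; rewrite /A /cap_graph /cap /= dotpC; tauto.
  rewrite mule0 -(measure0 mu); congr (mu _); rewrite ysectionE.
  apply/seteqP; split=> // x.
  rewrite /A /= => -[_ [_ yU']].
  by move/negP: yU; apply; exact: mem_set.
rewrite ge0_integralZl //; last by apply/measurable_EFinP.
by rewrite integral_indic // setIT.
Qed.

(** The case U = S of [double_cap], where the integrand is constant by invariance of nu. *)
Lemma cap_ratio t : (mu (cap t e) * nu setT = nu (cap t e) * mu setT)%E.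
Proof.
rewrite -double_cap //; under eq_integral do rewrite setTI (invariant_cap _ _ inu).
by rewrite integral_cst.
Qed.

Lemma invariant_le (U : set (sphere R d)) : open U ->
  (mu (U : set S) <= (fine (mu setT) / fine (nu setT))%:E * nu (U : set S))%E.
Proof.
move=> oU; have mU := borel_open oU.
(* Thresholds increasing to 1, so that the caps shrink to their centres. *)
pose t (k : nat) : R := 1 - k.+1%:R^-1.
have t1 k : t k < 1 by rewrite /t ltrBlDr ltrDl invr_gt0.
have finnu (A : set S) : measurable A -> nu A = (fine (nu A))%:E.
  by move=> mA; rewrite fineK // fin_num_measure.
have finmu (A : set S) : measurable A -> mu A = (fine (mu A))%:E.
  by move=> mA; rewrite fineK // fin_num_measure.
have mc k := measurable_cap (t k) e.
have h0 k : 0 < fine (nu (cap (t k) e)).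
  by rewrite -lte_fin -finnu //; exact: cap_gt0.
have T0 : 0 < fine (nu setT).
  by rewrite -lte_fin -finnu // lt0e nu0 measure_ge0.
(* The proportion, for nu, of the cap around x that lies in U; the denominator is taken at e since
   all these caps have equal mass. *)
pose f k (x : S) := ((fine (nu (cap (t k) e)))^-1%:E * nu (U `&` cap (t k) x))%E.
have f0 k x : (0 <= f k x)%E by rewrite mule_ge0 // lee_fin invr_ge0 ltW.
have mg k : measurable_fun setT (fun x : S => nu (U `&` cap (t k) x)).
  pose A := cap_graph (t k) `&` (setT `*` (U : set S)).
  have mA : measurable A.
    by apply: measurableI; [exact: measurable_cap_graph|exact: measurableX].
  have -> : (fun x => nu (U `&` cap (t k) x)) = nu \o xsection A.
    apply/funext => x /=; congr (nu _); rewrite xsectionE; apply/seteqP.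
    by split=> y; rewrite /A /cap_graph /cap /=; tauto.
  exact: measurable_fun_xsection.
have mf k : measurable_fun setT (f k) by exact: emeasurable_funM.
have intf k : (\int[mu]_(x in U) f k x <=
    (fine (mu setT) / fine (nu setT))%:E * nu (U : set S))%E.
  apply: (@le_trans _ _ (\int[mu]_x f k x)%E).
    by apply: ge0_subset_integral.
  rewrite ge0_integralZl //; last by rewrite lee_fin invr_ge0 ltW.
  (* The integral equals mu(cap) / nu(cap) times nu(U), and [cap_ratio] turns that quotient into
     mu(S) / nu(S), whatever k is. *)
  rewrite double_cap // muleA le_eqVlt; apply/orP; left; apply/eqP.
  congr (_ * _)%E; have := cap_ratio (t k).
  rewrite (finmu (cap _ _)) // (finmu setT) //.
  rewrite (finnu (cap _ _)) // (finnu setT) //.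
  rewrite -!EFinM => -[] E; congr EFin.
  by rewrite mulrC; apply/eqP; rewrite eqr_div ?lt0r_neq0 ?h0 // E mulrC.
apply: le_trans (limn_einf_le intf).
apply: le_trans (fatou mu mU (fun k => measurable_funTS (mf k))
  (fun k x _ => f0 k x)).
(* mu(U) is the integral of 1 over U; it remains to see that the lower limit of f_k is 1 on U. *)
rewrite -[leLHS]mul1e -integral_cst //.
rewrite le_eqVlt; apply/orP; left; apply/eqP.
apply: eq_integral => x /set_mem Ux.
have [s s1 sU] := open_contains_cap oU Ux.
apply/esym; rewrite (cvg_limn_einf_sup (l := 1%E)) //.
apply: cvg_near_cst.
have : \forall k \near \oo, s < t k.
  have s0 : 0 < 1 - s by rewrite subr_gt0.
  apply: filterS (near_infty_natSinv_lt (PosNum s0)) => k.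
  by rewrite -[_%:num]/(1 - s) ltrBrDr addrC -ltrBrDr.
(* Once t_k > s the cap around x lies inside U, and the proportion is exactly 1. *)
apply: filterS => k sk; rewrite /f setIidr.
  rewrite (invariant_cap (t k) x inu) -/e [X in (_ * X)%E]finnu // -EFinM.
  by rewrite mulVf ?lt0r_neq0 ?h0.
by move=> y /= ty; apply: sU => /=; exact: lt_trans ty.
Qed.

End comparison.

(** Exchanging mu and nu in [invariant_le] gives equality on open sets, which form a generating
    class stable under intersection; equality then extends to all Borel sets. *)
Lemma invariant_unique (mu nu : {finite_measure set S -> \bar R}) :
  invariant_measure mu -> invariant_measure nu ->
  mu setT != 0%E -> nu setT != 0%E ->
  forall A, measurable A ->
    mu A = ((fine (mu setT) / fine (nu setT))%:E * nu A)%E.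
Proof.
move=> imu inu mu0 nu0.
have c0 : 0 <= fine (mu setT) / fine (nu setT).
  by rewrite divr_ge0 // ltW // fine_measure_gt0.
pose m2 : {measure set S -> \bar R} := mscale (NngNum c0) nu.
move=> A mA; rewrite -[RHS]/(m2 A).
apply: (@measure_unique _ R S (@open (sphere R d)) (fun=> setT)) => //.
- exact: openI.
- by move=> _; exact: openT.
- by rewrite bigcup_const.
- move=> U oU; apply/eqP; rewrite eq_le (invariant_le imu inu nu0 oU) /=.
  have := invariant_le inu imu mu0 oU; rewrite /m2 /mscale /=.
  have mU := borel_open oU.
  rewrite -(@fineK _ (mu U)) ?fin_num_measure //.
  rewrite -(@fineK _ (nu U)) ?fin_num_measure //.
  rewrite -!EFinM !lee_fin mulrAC ler_pdivlMr ?fine_measure_gt0 // => h.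
  by rewrite mulrAC ler_pdivrMr ?fine_measure_gt0 // mulrC (le_trans h) // mulrC.
- by move=> _; rewrite ltey_eq fin_num_measure.
Qed.

End uniqueness.

(** * Transfer between the coset space and the sphere *)

Lemma exists_pushforward d1 d2 (X : measurableType d1) (Y : measurableType d2)
    (R : realType) (mu : {measure set X -> \bar R}) (f : X -> Y) :
  measurable_fun setT f ->
  exists nu : {measure set Y -> \bar R}, forall A, nu A = mu (f @^-1` A).
Proof.
by move=> mf; unshelve eexists (pushforward mu f).
Qed.

Lemma exists_pushforward_prob d1 d2 (X : measurableType d1) (Y : measurableType d2)
    (R : realType) (p : probability X R) (f : X -> Y) :
  measurable_fun setT f ->
  exists q : probability Y R, forall A, q A = p (f @^-1` A).
Proof.
move=> mf.
pose f' : {mfun X >-> Y} := HB.pack f (isMeasurableFun.Build _ _ _ _ _ mf).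
by exists (distribution p f').
Qed.

Lemma exists_finite_measure d (X : measurableType d) (R : realType)
    (mu : {measure set X -> \bar R}) : (mu setT < +oo)%E ->
  exists nu : {finite_measure set X -> \bar R}, forall A, nu A = mu A.
Proof.
(* Restricting to the whole space changes no value and supplies the finite-measure structure. *)
move=> mufin; exists (mfrestr measurableT mufin) => A.
exact: (congr1 mu (setIT A)).
Qed.

(** Covers infinite I as well: [fine] sends it to 0, whose inverse is 0, so both sides vanish. *)
Lemma ratio_scale (R : realType) (c : R) (I J : \bar R) : 0 < c ->
  ((fine (c%:E * I))^-1%:E * (c%:E * J) = (fine I)^-1%:E * J)%E.
Proof.
move=> c0; have cn0 : c != 0 by rewrite lt0r_neq0.
case: I => [r||].
- by rewrite muleA -!EFinM /= invfM mulrAC mulVf // mul1r.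
- by rewrite gt0_muley ?lte_fin // /= invr0 !mul0e.
- by rewrite gt0_muleNy ?lte_fin // /= invr0 !mul0e.
Qed.

(** With an infinite integral the normalizing factor would be 0, contradicting total mass 1. *)
Lemma has_density_finite d (T : measurableType d) (R : realType)
    (mu : {measure set T -> \bar R}) (w : T -> R) (p : probability T R) :
  has_density mu w p -> (weighted mu w setT < +oo)%E.
Proof.
move=> /(_ setT measurableT); rewrite probability_setT.
case: (weighted _ _ _) => [r _||]; rewrite ?ltry //=.
by rewrite invr0 mul0e => /eqP; rewrite eqe oner_eq0.
Qed.

Section transfer.
Variables (R : realType) (d : nat).
Hypothesis d0 : (0 < d)%N.
Local Notation S := (borel (sphere R d)).
Local Notation X := (borel (coset_space (@SO_lower R d))).
Local Notation f := (@coset_sphere R d : X -> S).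
Local Notation h := (sphere_coset d0 : S -> X).

Let mf : measurable_fun setT f.
Proof. exact: (borel_continuous (@coset_sphere_continuous R d)). Qed.

Let mh : measurable_fun setT h.
Proof. exact: (borel_continuous (@sphere_coset_continuous R d d0)). Qed.

Let fh B : h @^-1` (f @^-1` B) = B.
Proof. by apply/seteqP; split=> x /=; rewrite sphere_cosetK. Qed.

Let hf A : f @^-1` (h @^-1` A) = A.
Proof. by apply/seteqP; split=> x /=; rewrite coset_sphereK. Qed.

Let measurable_f (B : set S) : measurable B -> measurable (f @^-1` B).
Proof. by move=> mB; rewrite -[X in measurable X]setTI; exact: mf. Qed.

Let measurable_h (A : set X) : measurable A -> measurable (h @^-1` A).
Proof. by move=> mA; rewrite -[X in measurable X]setTI; exact: mh. Qed.

Lemma coset_sphere_act g x : f (coset_act g x) = sphere_act g (f x).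
Proof. by rewrite /coset_act coset_sphereE sphere_actM. Qed.

Lemma radon_sphere_finite (mu : {measure set S -> \bar R}) :
  radon mu -> (mu setT < +oo)%E.
Proof. by move=> [+ _ _]; apply; exact: sphere_compact. Qed.

Lemma coset_space_compact : compact [set: coset_space (@SO_lower R d)].
Proof.
have -> : [set: coset_space (@SO_lower R d)] = sphere_coset d0 @` setT.
  by apply/seteqP; split=> // x _; exists (f x) => //; rewrite coset_sphereK.
apply: continuous_compact; last exact: sphere_compact.
exact/continuous_subspaceT/sphere_coset_continuous.
Qed.

Lemma admissible_sphere (nu : {measure set X -> \bar R}) :
  admissible_measure nu ->
  exists mu : {finite_measure set S -> \bar R},
    [/\ forall B, mu B = nu (f @^-1` B), invariant_measure mu & mu setT != 0%E].
Proof.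
move=> [[nufin _ _] nu0 [chi chi0 nuchi]].
have nuT : (nu setT < +oo)%E by apply: nufin; exact: coset_space_compact.
have [nu' nu'E] := exists_pushforward nu mf.
have [|mu muE] := @exists_finite_measure _ _ _ nu'; first by rewrite nu'E.
have E B : mu B = nu (f @^-1` B) by rewrite muE nu'E.
exists mu; split=> //; last by rewrite E preimage_setT.
(* On the whole space, which has finite nonzero mass, relative invariance reads nu(X) = chi(g)^-1
   nu(X). *)
have chi1 g : ((chi g)^-1)%:E = 1%E.
  have := nuchi g setT measurableT; rewrite /pushforward preimage_setT.
  have : nu setT \is a fin_num by rewrite ge0_fin_numE ?measure_ge0.
  move: nu0; case: (nu setT) => // r; rewrite eqe => r0 _ [] E1.
  by congr EFin; apply: (mulIf r0); rewrite mul1r -E1.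
move=> g B mB; rewrite !E -[RHS]mul1e -(chi1 g) -nuchi; last exact: measurable_f.
rewrite /pushforward; congr (nu _).
by apply/seteqP; split=> x; rewrite /= coset_sphere_act.
Qed.

(** Ensures that the quantification over nu in the theorem is not vacuous. The measure dx is carried
    over by the inverse homeomorphism, which respects open and compact sets and hence regularity;
    its multiplier is 1. *)
Lemma admissible_exists (dx : {measure set S -> \bar R}) :
  uniform_measure dx ->
  exists nu : {measure set X -> \bar R}, admissible_measure nu.
Proof.
move=> [[dxK dxO dxI] dx0 dxinv].
have [nu nuE] := exists_pushforward dx mh.
have openh U : open U -> open (h @^-1` U).
  by move/continuousP: (@sphere_coset_continuous R d d0) => /(_ U).
have openf U : open U -> open (f @^-1` U).
  by move/continuousP: (@coset_sphere_continuous R d) => /(_ U).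
have compacth K : compact K -> compact (h @^-1` K).
  move=> cK; have -> : h @^-1` K = @coset_sphere R d @` K.
    apply/seteqP; split=> [x Kx|_ [y Ky <-] /=]; last by rewrite coset_sphereK.
    by exists (h x) => //; rewrite sphere_cosetK.
  apply: continuous_compact => //.
  exact/continuous_subspaceT/coset_sphere_continuous.
have compactf K : compact K -> compact (f @^-1` K).
  move=> cK; have -> : f @^-1` K = sphere_coset d0 @` K.
    apply/seteqP; split=> [x Kx|_ [y Ky <-] /=]; last by rewrite sphere_cosetK.
    by exists (f x) => //; rewrite coset_sphereK.
  apply: continuous_compact => //.
  exact/continuous_subspaceT/sphere_coset_continuous.
exists nu; split.
- split.
  + by move=> K cK; rewrite nuE; apply: dxK; exact: compacth.
  + move=> A mA; rewrite nuE dxO; last exact: measurable_h.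
    congr ereal_inf; apply/seteqP; split=> _ /= [U [oU AU] <-].
      exists (f @^-1` U); last by rewrite nuE fh.
      split; first exact: openf.
      by rewrite -[A]hf; exact: preimage_subset.
    exists (h @^-1` U); last by rewrite nuE.
    by split; [exact: openh|exact: preimage_subset].
  + move=> U oU; rewrite nuE dxI; last exact: openh.
    congr ereal_sup; apply/seteqP; split=> _ /= [K [cK KU] <-].
      exists (f @^-1` K); last by rewrite nuE fh.
      split; first exact: compactf.
      by rewrite -[U]hf; exact: preimage_subset.
    exists (h @^-1` K); last by rewrite nuE.
    by split; [exact: compacth|exact: preimage_subset].
- by rewrite nuE preimage_setT.
- exists (fun=> 1) => // g A mA; rewrite invr1 mul1e /pushforward !nuE.
  rewrite -(dxinv g (h @^-1` A)); last exact: measurable_h.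
  congr (dx _); suff E x : h (sphere_act g x) = coset_act g (h x).
    by apply/seteqP; split=> x; rewrite /= E.
  by rewrite -{1}[x](sphere_cosetK d0) -coset_sphere_act coset_sphereK.
Qed.

Lemma admissible_uniform (dx : {measure set S -> \bar R})
    (nu : {measure set X -> \bar R}) :
  uniform_measure dx -> admissible_measure nu ->
  exists2 c : R, 0 < c &
    forall B, measurable B -> nu (f @^-1` B) = (c%:E * dx B)%E.
Proof.
move=> [dxR dx0 dxinv] /admissible_sphere[mu [muE imu mu0]].
have [dx' dxE] := exists_finite_measure (radon_sphere_finite dxR).
have dx'0 : dx' setT != 0%E by rewrite dxE.
have idx : invariant_measure dx' by move=> g B mB; rewrite !dxE; exact: dxinv.
exists (fine (mu setT) / fine (dx' setT)); first by rewrite divr_gt0 ?fine_measure_gt0.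
by move=> B mB; rewrite -muE -dxE; exact: invariant_unique.
Qed.

(** Change of variables along [f], after which the pushforward of nu is c dx on measurable sets. *)
Lemma weighted_transfer (dx : {measure set S -> \bar R})
    (nu : {measure set X -> \bar R}) (c : R) (w : S -> R) (B : set S) :
  0 < c -> (forall B, measurable B -> nu (f @^-1` B) = (c%:E * dx B)%E) ->
  measurable_fun setT w -> (forall x, 0 <= w x) -> measurable B ->
  weighted nu (w \o f) (f @^-1` B) = (c%:E * weighted dx w B)%E.
Proof.
move=> c0 nuE mw w0 mB; rewrite /weighted.
have mwB : measurable_fun B (fun x => (w x)%:E).
  by apply/measurable_EFinP; exact: measurable_funTS.
have w0B : {in B, forall x, (0 <= (w x)%:E)%E} by move=> x _; rewrite lee_fin.
rewrite -(ge0_integral_pushforward mf nu mB mwB w0B).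
have c0' : 0 <= c by exact: ltW.
have mwB0 x : B x -> (0 <= (w x)%:E)%E by rewrite lee_fin.
rewrite -[RHS](ge0_integral_mscale dx mB (NngNum c0') mwB mwB0).
by apply: eq_measure_integral => A mA _; exact: nuE.
Qed.

(** The constant c cancels between the integral over a set and the normalizing integral. *)
Lemma has_density_transfer (dx : {measure set S -> \bar R})
    (nu : {measure set X -> \bar R}) (c : R) (w : S -> R)
    (p : probability X R) (q : probability S R) :
  0 < c -> (forall B, measurable B -> nu (f @^-1` B) = (c%:E * dx B)%E) ->
  measurable_fun setT w -> (forall x, 0 <= w x) ->
  (forall B, measurable B -> q B = p (f @^-1` B)) ->
  has_density nu (w \o f) p <-> has_density dx w q.
Proof.
move=> c0 nuE mw w0 qp.
have E B : measurable B ->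
    ((fine (weighted nu (w \o f) setT))^-1%:E * weighted nu (w \o f) (f @^-1` B)
     = (fine (weighted dx w setT))^-1%:E * weighted dx w B)%E.
  move=> mB; rewrite -{1}(preimage_setT f) !(weighted_transfer c0 nuE mw w0) //.
  exact: ratio_scale.
split=> [pd B mB|qd A mA].
  by rewrite qp // pd ?E //; exact: measurable_f.
by rewrite -[A]hf -qp ?E ?qd //; exact: measurable_h.
Qed.

Lemma FB_weight_measurable mu A : measurable_fun setT (@FB_weight R d mu A).
Proof.
apply: borel_continuous_real => x; apply: continuous_comp.
  2: exact: continuous_expR.
have cv i j : continuous (fun x : sphere R d => sphere_vec x i j).
  by rewrite ord1; exact: sphere_coord_continuous.
have cc m n (M : 'M[R]_(m, n)) i j : continuous (fun _ : sphere R d => M i j).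
  exact: cst_continuous.
apply: continuousB.
  by apply: continuousN; apply: mulmx_entry_continuous.
apply: mulmx_entry_continuous => // i j; apply: mulmx_entry_continuous => // k l.
  have -> : (fun x : sphere R d => (sphere_vec x)^T k l)
      = fun x => sphere_vec x l k by apply/funext => y; rewrite mxE.
  exact: cv.
Qed.

Lemma method_weightE (phi : 'Hom(FB_space R d, R^o)) (tau : SO R d.+1 -> R) :
  (forall g, tau g = 0) ->
  method_weight (@FB_rep R d) (FB_vec R d) (phi, tau)
  = FB_weight (functional_vec phi) (Subvs (functional_mx_Sym phi)) \o f.
Proof.
move=> tau0; apply/funext => x; rewrite /method_weight /FB_weight /= tau0 addr0.
rewrite functionalE; have [-> ->] := FB_rep_vec (repr (x : coset_space _)).
by rewrite frob_outer opprD.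
Qed.

Lemma method_weight_functional (mu : 'cV[R]_d.+1) (A : subvs_of (Sym R d.+1)) :
  method_weight (H := @SO_lower R d) (@FB_rep R d) (FB_vec R d)
    (linfun (FB_functional mu A), fun=> 0) = FB_weight mu A \o f.
Proof.
apply/funext => x; rewrite /method_weight /FB_weight /= addr0 lfunE /=.
rewrite /FB_functional; have [-> ->] := FB_rep_vec (repr (x : coset_space _)).
by rewrite frob_outer opprD.
Qed.

End transfer.

(* n = d.+1 *)
Theorem proposition4p15 (R : realType) (d : nat) (n_ge2 : (2 <= d.+1)%N) :
  [/\ closed [set g : SO R d.+1 | g \in @SO_lower R d],
      continuous_representation (@FB_rep R d)
    & fixed_by (@SO_lower R d) (@FB_rep R d) (FB_vec R d)] /\
  ((forall g : SO R d.+1,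
      coset_sphere (coset_pi (@SO_lower R d) g) = sphere_act g (sphere_e1 R d)) /\
   homeomorphism (@coset_sphere R d)) /\
  forall dx : {measure set (borel (sphere R d)) -> \bar R},
    uniform_measure dx ->
    (exists nu : {measure set (borel (coset_space (@SO_lower R d))) -> \bar R},
       admissible_measure nu) /\
    forall nu : {measure set (borel (coset_space (@SO_lower R d))) -> \bar R},
      admissible_measure nu ->
      image_family
        (@coset_sphere R d
           : borel (coset_space (@SO_lower R d)) -> borel (sphere R d))
        (method_family (@FB_rep R d) (FB_vec R d) nu)
      = fisher_bingham dx.
Proof.
have d0 : (0 < d)%N by [].
split; first split.
- exact: SO_lower_closed.
- exact: FB_continuous_representation.
- exact: FB_vec_fixed.
split; first split.
- exact: coset_sphereE.
- split; first exact: coset_sphere_continuous.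
  exists (sphere_coset d0); split.
  + exact: sphere_coset_continuous.
  + exact: coset_sphereK.
  + exact: sphere_cosetK.
move=> dx dxU; split; first exact: admissible_exists dxU.
move=> nu /(admissible_uniform d0 dxU)[c c0 nuE].
have mFB := @FB_weight_measurable R d.
have FB0 (mu : 'cV[R]_d.+1) A x : 0 <= FB_weight mu A x by exact: expR_ge0.
apply/seteqP; split=> q.
- move=> [p [[phi tau] [Wtau _]]] /=.
  (* W_0 is trivial, so tau vanishes and the weight depends on phi alone. *)
  rewrite method_weightE => [pd qp|]; last exact: W0_SO d0 Wtau.
  exists (functional_vec phi, Subvs (functional_mx_Sym phi)).
  exact: (proj1 (has_density_transfer d0 c0 nuE (mFB _ _) (FB0 _ _) qp) pd).
- move=> [[mu A] /= qd].
  have mh := borel_continuous (@sphere_coset_continuous R d d0).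
  (* The preimage of q in the method's family is its transport by the inverse homeomorphism. *)
  have [p pE] := exists_pushforward_prob q mh.
  have qp B : measurable B ->
      q B = p ((@coset_sphere R d : borel _ -> borel (sphere R d)) @^-1` B).
    move=> _; rewrite pE; congr (q _); apply/seteqP.
    by split=> x; rewrite /= sphere_cosetK.
  have pd : has_density nu (FB_weight mu A \o @coset_sphere R d) p.
    exact: (proj2 (has_density_transfer d0 c0 nuE (mFB _ _) (FB0 _ _) qp) qd).
  exists p => //.
  exists (linfun (FB_functional mu A), fun=> 0); last first.
    by rewrite method_weight_functional.
  (* The integrability required by [Theta] is read off from p being a probability with this
     density. *)
  split; last by rewrite method_weight_functional; exact: has_density_finite pd.
  split=> //= [|g h]; first exact: cst_continuous.
  by rewrite addr0.
Qed.
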